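(* Let $\lambda>0$, let $\nu$ be a non-negative measure on $(0,\infty)$ with $\int_0^\infty (s\wedge 1)\,\nu(ds)<\infty$, and let $f(x)=\int_0^\infty (1-e^{-xs})\,\nu(ds)$. Let $N^f(t)$, $t\ge 0$, be the generalized Poisson counting process associated with $(\lambda,\nu)$ (defined in the context), let $N$ be a homogeneous Poisson process with rate $\lambda$, and let $H^f$ be a subordinator, independent of $N$, with Laplace transform $\mathbb{E}e^{-\mu H^f(t)}=e^{-tf(\mu)}$. Then for every $t>0$ and $|u|<1$, $$\mathbb{E}\,u^{N(H^f(t))}=e^{-tf(\lambda(1-u))},$$ and $$N^f(t)\ \stackrel{\text{law}}{=}\ N(H^f(t)).$$
   Context: The generalized Poisson counting process $N^f(t)$, $t\ge0$, associated with $(\lambda,\nu)$ is a non-negative integer-valued process with $N^f(0)=0$, with independent and stationary increments, such that, writing $N^f[t,t+dt)$ for the increment over $[t,t+dt)$, as $dt\downarrow 0$, $$\Pr\{N^f[t,t+dt)=k\}=\begin{cases} dt\,\dfrac{\lambda^k}{k!}\displaystyle\int_0^\infty e^{-\lambda s}s^k\,\nu(ds)+o(dt), & k\ge 1,\\[2mm] 1-dt\displaystyle\int_0^\infty(1-e^{-\lambda s})\,\nu(ds)+o(dt), & k=0.\end{cases}$$ *)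

(* Defs.v *)
From HB Require Import structures.
From mathcomp Require Import all_boot all_order all_algebra.
From mathcomp Require Import all_classical all_reals all_analysis.

Set Implicit Arguments.
Unset Strict Implicit.
Unset Printing Implicit Defensive.

Import Order.TTheory GRing.Theory Num.Theory.
Import numFieldNormedType.Exports.

Local Open Scope classical_set_scope.
Local Open Scope ring_scope.

(* Processes are indexed by R, but only the times t >= 0 are ever constrained
   or used. *)

Definition increment (R : realType) (T : Type) (X : R -> T -> R) (s t : R) :
  T -> R := fun w => X t w - X s w.

(* Increments are taken in R: subtraction on nat is truncated. *)
Definition real_process (R : realType) (T : Type) (N : R -> T -> nat) :
  R -> T -> R := fun t w => (N t w)%:R.

(* The events A i may be the whole space, so the product rule over all of 'I_n
   contains the product rule over each of its subsets. *)
Definition mutually_independent (R : realType) (d : measure_display)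
    (T : measurableType d) (P : probability T R) (n : nat)
    (X : 'I_n -> T -> R) : Prop :=
  forall A : 'I_n -> set R, (forall i, measurable (A i)) ->
    P (\bigcap_(i in [set: 'I_n]) X i @^-1` A i) =
    (\big[*%E/1]_(i < n) P (X i @^-1` A i))%E.

(* Measurability is included so that a map such as w |-> N (H t w) w, which is
   not packaged as a random variable, is claimed to be one. *)
Definition equal_in_law (R : realType) (d d1 d2 : measure_display)
    (S : measurableType d) (T1 : measurableType d1) (T2 : measurableType d2)
    (P1 : probability T1 R) (P2 : probability T2 R)
    (X1 : T1 -> S) (X2 : T2 -> S) : Prop :=
  [/\ measurable_fun setT X1, measurable_fun setT X2 &
      forall A : set S, measurable A -> P1 (X1 @^-1` A) = P2 (X2 @^-1` A)].

Definition independent_increments (R : realType) (d : measure_display)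
    (T : measurableType d) (P : probability T R) (X : R -> T -> R) : Prop :=
  forall (n : nat) (t : nat -> R), 0 <= t 0%N ->
    (forall i, t i <= t i.+1) ->
    mutually_independent P (fun i : 'I_n => increment X (t i) (t i.+1)).

Definition stationary_increments (R : realType) (d : measure_display)
    (T : measurableType d) (P : probability T R) (X : R -> T -> R) : Prop :=
  forall s t h : R, 0 <= s -> 0 <= t -> 0 <= h ->
    equal_in_law P P (increment X s (s + h)) (increment X t (t + h)).

Definition nondecreasing_paths (R : realType) (T : Type) (X : R -> T -> R) :
    Prop :=
  forall (w : T) (s t : R), 0 <= s -> s <= t -> X s w <= X t w.

Definition right_continuous_paths (R : realType) (T : Type)
    (X : R -> T -> R) : Prop :=
  forall (w : T) (t : R), 0 <= t -> X s w @[s --> t^'+] --> X t w.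

Definition process_sigma_algebra (R : realType) (d d' : measure_display)
    (T : measurableType d) (S : measurableType d') (X : R -> T -> S) :
    set (set T) :=
  <<s \bigcup_(t in [set t : R | 0 <= t])
        preimage_set_system setT (X t) measurable >>.

Definition independent_processes (R : realType) (d d1 d2 : measure_display)
    (T : measurableType d) (S1 : measurableType d1) (S2 : measurableType d2)
    (P : probability T R) (X : R -> T -> S1) (Y : R -> T -> S2) : Prop :=
  forall A B : set T,
    process_sigma_algebra X A -> process_sigma_algebra Y B ->
    P (A `&` B) = (P A * P B)%E.

(* A measure on (0, oo) is a measure on R giving no mass to ]-oo, 0]. *)
Record is_bernstein_measure (R : realType) (nu : {measure set R -> \bar R}) :
    Prop := IsBernsteinMeasure {
  bernstein_measure_support : nu `]-oo, 0]%classic = 0%E ;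
  bernstein_measure_integral :
    (\int[nu]_(s in `]0%R, +oo[) (Num.min s 1)%:E < +oo)%E }.

Definition bernstein (R : realType) (nu : {measure set R -> \bar R}) (x : R) :
    R :=
  \int[nu]_(s in `]0, +oo[) (1 - expR (- x * s)).

Definition jump_rate (R : realType) (lambda : R)
    (nu : {measure set R -> \bar R}) (k : nat) : R :=
  lambda ^+ k / k`!%:R *
  \int[nu]_(s in `]0, +oo[) (expR (- lambda * s) * s ^+ k).

(* Paths are not assumed monotone or right-continuous. The increment over
   [t, t + dt) is X (t + dt) - X t. *)
Record is_generalized_poisson (R : realType) (d : measure_display)
    (T : measurableType d) (P : probability T R) (lambda : R)
    (nu : {measure set R -> \bar R}) (X : R -> {RV P >-> nat}) : Prop :=
  IsGeneralizedPoisson {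
  generalized_poisson0 : forall w, X 0 w = 0%N ;
  generalized_poisson_indep : independent_increments P (real_process X) ;
  generalized_poisson_stat : stationary_increments P (real_process X) ;
  generalized_poisson_jump : forall (t : R) (k : nat), 0 <= t -> (0 < k)%N ->
    (fun dt : R => fine
       (P [set w | increment (real_process X) t (t + dt) w = k%:R]))
    = (fun dt : R => dt * jump_rate lambda nu k)
      +o_ (0^'+) (fun dt : R => dt) ;
  generalized_poisson_nojump : forall t : R, 0 <= t ->
    (fun dt : R => fine
       (P [set w | increment (real_process X) t (t + dt) w = 0]))
    = (fun dt : R =>
         1 - dt * \int[nu]_(s in `]0, +oo[) (1 - expR (- lambda * s)))
      +o_ (0^'+) (fun dt : R => dt) }.

Record is_poisson_process (R : realType) (d : measure_display)
    (T : measurableType d) (P : probability T R) (lambda : R)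
    (N : R -> {RV P >-> nat}) : Prop := IsPoissonProcess {
  poisson_process0 : forall w, N 0 w = 0%N ;
  poisson_process_nondecreasing : nondecreasing_paths (real_process N) ;
  poisson_process_right_continuous :
    right_continuous_paths (real_process N) ;
  poisson_process_indep : independent_increments P (real_process N) ;
  poisson_process_law : forall (s t : R) (k : nat), 0 <= s -> s < t ->
    P [set w | increment (real_process N) s t w = k%:R] =
    (poisson_pmf (lambda * (t - s)) k)%:E }.

Record is_subordinator (R : realType) (d : measure_display)
    (T : measurableType d) (P : probability T R) (H : R -> {RV P >-> R}) :
    Prop := IsSubordinator {
  subordinator0 : forall w, H 0 w = 0 ;
  subordinator_nondecreasing : nondecreasing_paths H ;
  subordinator_right_continuous : right_continuous_paths H ;
  subordinator_indep : independent_increments P H ;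
  subordinator_stat : stationary_increments P H }.

Definition has_laplace_exponent (R : realType) (d : measure_display)
    (T : measurableType d) (P : probability T R) (f : R -> R)
    (H : R -> {RV P >-> R}) : Prop :=
  forall t mu : R, 0 <= t -> 0 <= mu ->
    'E_P[(fun w => expR (- mu * H t w))%R]%E = (expR (- t * f mu))%:E.

Definition subordinated (R : realType) (T S : Type) (N : R -> T -> S)
  (H : R -> T -> R) : R -> T -> S := fun t w => N (H t w) w.

(* Main.v *)
Require Import Defs.
From HB Require Import structures.
From mathcomp Require Import all_boot all_order all_algebra.
From mathcomp Require Import all_classical all_reals all_analysis.
From mathcomp Require Import ring lra.
From mathcomp Require Import measurable_realfun.

Set Implicit Arguments.
Unset Strict Implicit.
Unset Printing Implicit Defensive.

Import Order.TTheory GRing.Theory Num.Theory.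
Import numFieldNormedType.Exports.

Local Open Scope classical_set_scope.
Local Open Scope ring_scope.

(** Both variables have a probability generating function (pgf) that can be
computed, and the two functions agree on ]0, 1[, which determines a law on the
natural numbers (pgf_inj, nat_law_eq). Write f for bernstein nu and
a = f (lambda (1 - u)).

For the subordinated process, condition on the subordinator: N(s) is Poisson of
parameter lambda s, so E u^N(s) = exp(- lambda (1 - u) s), and replacing s by
the independent time H(t) gives the Laplace transform of H(t) at
lambda (1 - u), which is exp(- t a). Conditioning on a real random variable is
avoided by approximating H(t) from the right by times on the grid of mesh
1 / (n + 1): on the grid the mixture is a countable sum (Rintegral_mixture), and
right-continuity of the paths of N with dominated convergence gives the limit
(pgf_subordinated). The same approximation shows that N(H(t)) is measurable.

For the generalized Poisson process X, let phi(h) be the pgf of X(h) at u, with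
0 < u < 1. Independence and stationarity of the increments give
phi(s + h) = phi(s) phi(h) (generalized_poisson_pgfD). The jump probabilities
determine the derivative of phi at 0: the tail beyond n jumps is at most
u^(n+1) (1 - P(X(h) = 0)), which is O(h) with an arbitrarily small constant, so
the limit h -> 0 passes through the series, and (1 - phi(h)) / h tends to
f(lambda) - sum_(k >= 1) u^k jump_rate(k) = a (cvg_pgf_quotient). Here the value
of the sum comes from the exponential series under the integral against nu
(cvg_jump_rate_series). Finally phi(t) = phi(t / m)^m is compared with
exp(- t a) = exp(- a t / m)^m through |x^m - y^m| <= m |x - y|
(generalized_poisson_pgf). *)

(** * Numerical estimates *)

Lemma normr_exprn_le1 (R : realDomainType) (u : R) n :
  `|u| <= 1 -> `|u ^+ n| <= 1.
Proof. by move=> u1; rewrite normrX exprn_ile1. Qed.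

Lemma natr_dist_lt1 (R : realDomainType) (m n : nat) :
  `|m%:R - n%:R : R| < 1 -> m = n.
Proof.
wlog mn : m n / (m <= n)%N.
  move=> wh; case: (leqP m n) => [|/ltnW nm]; [|rewrite distrC]; move=> /wh//.
  by move=> /(_ nm).
move: mn; rewrite leq_eqVlt => /predU1P[//|].
rewrite -(ler_nat R) -natr1 => mn.
by rewrite distrC ger0_norm; [move=> ?; exfalso; lra|lra].
Qed.

(** This turns the infinitesimal comparison of two multiplicative functions into
a comparison at a fixed time. *)
Lemma dist_expr_le (R : realDomainType) (a b : R) n : `|a| <= 1 -> `|b| <= 1 ->
  `|a ^+ n - b ^+ n| <= n%:R * `|a - b|.
Proof.
move=> a1 b1; elim: n => [|n IHn]; first by rewrite subrr normr0 mul0r.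
rewrite !exprS (_ : _ - _ = a * (a ^+ n - b ^+ n) + (a - b) * b ^+ n); last by ring.
rewrite (le_trans (ler_normD _ _))// !normrM -natr1 mulrDl mul1r lerD//.
  by rewrite (le_trans _ IHn)// ler_piMl.
by rewrite ler_piMr// normrX exprn_ile1.
Qed.

(** Upper bound: exp(-y) <= 1 / (1 + y) <= 1 - y + y^2. *)
Lemma expRN_taylor1 (R : realType) (y : R) : 0 <= y ->
  `|expR (- y) - (1 - y)| <= y ^+ 2.
Proof.
move=> y0; rewrite ger0_norm ?subr_ge0 ?expR_ge1Dx//.
rewrite lerBlDr expRN.
have y1 : 0 < 1 + y by lra.
apply: (@le_trans _ _ (1 + y)^-1).
  by rewrite lef_pV2 ?posrE ?expR_gt0// expR_ge1Dx.
rewrite -[X in X <= _]mul1r ler_pdivrMr//; nra.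
Qed.

Lemma series_exp_coeff_le (R : realType) (x : R) n :
  0 <= x -> series (exp_coeff x) n <= expR x.
Proof.
move=> x0; apply: nondecreasing_cvgn_le; last exact: is_cvg_series_exp_coeff.
by apply: nondecreasing_series => k _ _; exact: exp_coeff_ge0.
Qed.

(** An expansion b + h c + o(h) at the right of 0, restated as the limit of a
quotient. *)
Lemma littleo_cvg_quotient (R : realType) (f g : R -> R) (b c : R) :
  (forall h, g h = b + h * c) -> f = g +o_ (0^'+) (fun h : R => h) ->
  (f h - b) / h @[h --> 0^'+] --> c.
Proof.
move=> gE /eqaddoP fg; apply/cvgrPdist_le => e e0.
near=> h.
have h0 : 0 < h by near: h; exact: nbhs_right_gt.
have : `|f h - g h| <= e * `|h| by near: h; exact: fg.
have -> : c - (f h - b) / h = (g h - f h) / h.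
  by rewrite gE; field; exact: lt0r_neq0.
by rewrite normrM normfV (gtr0_norm h0) ler_pdivrMr// distrC.
Unshelve. all: by end_near. Qed.

(** * Integration along the fibres of an integer-valued map *)

Lemma dominated_cvg_Rintegral (R : realType) (d : measure_display)
    (T : measurableType d) (mu : {measure set T -> \bar R}) (D : set T)
    (fn : nat -> T -> R) (f g : T -> R) :
  measurable D -> (forall n, measurable_fun D (fn n)) ->
  mu.-integrable D (EFin \o g) ->
  (forall n x, D x -> `|fn n x| <= g x) ->
  (forall x, D x -> fn ^~ x @ \oo --> f x) ->
  \int[mu]_(x in D) fn n x @[n --> \oo] --> \int[mu]_(x in D) f x.
Proof.
move=> mD mfn ig fng fnf.
have mf : measurable_fun D f := measurable_fun_cvg mfn fnf.
have mfnE n : measurable_fun D (EFin \o fn n) by exact/measurable_EFinP.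
have mfE : measurable_fun D (EFin \o f) by exact/measurable_EFinP.
have fnfE : {ae mu, forall x, D x ->
    (fun n => (EFin \o fn n) x) @ \oo --> (EFin \o f) x}.
  by apply/aeW => x Dx; apply: cvg_EFin; [exact: nearW|exact: fnf].
have fngE : {ae mu, forall x, forall n, D x ->
    `|(EFin \o fn n) x| <= (EFin \o g) x}%E.
  by apply/aeW => x n Dx; rewrite /= lee_fin fng.
have [intf _] := dominated_convergence mD mfnE mfE fnfE ig fngE.
rewrite -[X in _ --> X -> _]fineK; last exact: integrable_fin_num.
by move=> /fine_cvgP[_].
Qed.

Section bounded_expectation.
Context (R : realType) (d : measure_display) (T : measurableType d).
Variable P : probability T R.
Implicit Types (D : set T) (Z : T -> R) (K : T -> nat).

Lemma bounded_integrable D Z (C : R) : measurable D -> measurable_fun setT Z ->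
  (forall w, `|Z w| <= C) -> P.-integrable D (EFin \o Z).
Proof.
move=> mD mZ ZC; apply: measurable_bounded_integrable => //.
- by rewrite (le_lt_trans (probability_le1 P mD))// ltry.
- exact: measurable_funTS.
- exists C; split; first exact: num_real.
  by move=> x Cx w _ /=; rewrite (le_trans (ZC w))// ltW.
Qed.

Lemma Rintegral_cstT (c : R) : \int[P]_w c = c.
Proof.
by rewrite Rintegral_cst// [X in _ * X](congr1 fine (@probability_setT _ _ _ P)) mulr1.
Qed.

Lemma bounded_cvg_Rintegral (Zn : nat -> T -> R) Z (C : R) :
  (forall n, measurable_fun setT (Zn n)) ->
  (forall n w, `|Zn n w| <= C) ->
  (forall w, Zn ^~ w @ \oo --> Z w) ->
  \int[P]_w Zn n w @[n --> \oo] --> \int[P]_w Z w.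
Proof.
move=> mZn ZnC ZnZ; apply: (@dominated_cvg_Rintegral _ _ _ _ _ _ _ (cst C)) => //.
by apply: (@bounded_integrable _ (cst C) `|C|).
Qed.

Lemma measurable_fun_natP K : measurable_fun setT K <->
  forall k, measurable (K @^-1` [set k]).
Proof.
split=> [mK k|mK _ A _]; first by rewrite -[X in measurable X]setTI; exact: mK.
rewrite setTI (_ : K @^-1` A = \bigcup_(k in A) K @^-1` [set k]).
  by apply: bigcup_measurable => k _; exact: mK.
by apply/seteqP; split=> [w AKw|w [k Ak] /= ->//]; exists (K w).
Qed.

Lemma measurable_preimage_nat K (A : set nat) : measurable_fun setT K ->
  measurable (K @^-1` A).
Proof. by move=> mK; rewrite -[X in measurable X]setTI; exact: mK. Qed.

Lemma measurable_natf K (g : nat -> R) : measurable_fun setT K ->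
  measurable_fun setT (g \o K).
Proof. by move=> mK; apply: measurableT_comp. Qed.

Lemma Rintegral_lt_nat K Z (C : R) n : measurable_fun setT K ->
  measurable_fun setT Z -> (forall w, `|Z w| <= C) ->
  \int[P]_(w in [set w | (K w < n)%N]) Z w =
  \sum_(k < n) \int[P]_(w in K @^-1` [set (k : nat)]) Z w.
Proof.
move=> mK mZ ZC; have mKlt m : measurable [set w | (K w < m)%N].
  exact: (measurable_preimage_nat [set k | (k < m)%N]).
elim: n => [|n IHn].
  by rewrite big_ord0 (_ : [set w | _] = set0) ?Rintegral_set0//; apply/seteqP; split.
have mKn := (measurable_fun_natP K).1 mK n.
rewrite big_ord_recr/= -IHn -Rintegral_setU//.
- congr Rintegral; apply/seteqP; split => w /=.
    by rewrite ltnS leq_eqVlt => /orP[/eqP|]; [right|left].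
  by case=> [Kn|->//]; rewrite ltnS ltnW.
- by apply: bounded_integrable ZC => //; exact: measurableU.
- by apply/disj_setPS => w /= [] /[swap] ->; rewrite ltnn.
Qed.

Lemma cvg_Rintegral_fibres K Z (C : R) : measurable_fun setT K ->
  measurable_fun setT Z -> (forall w, `|Z w| <= C) ->
  \sum_(k < n) \int[P]_(w in K @^-1` [set (k : nat)]) Z w @[n --> \oo] -->
  \int[P]_w Z w.
Proof.
move=> mK mZ ZC.
have mKlt m : measurable [set w | (K w < m)%N].
  exact: (measurable_preimage_nat [set k | (k < m)%N]).
under eq_fun => n do rewrite -(Rintegral_lt_nat n mK mZ ZC) Rintegral_mkcond.
apply: (@bounded_cvg_Rintegral _ _ C).
- move=> n; apply/(measurable_restrictT Z (mKlt n)).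
  exact: measurable_funTS.
- move=> n w; rewrite /patch; case: ifPn => _ //.
  by rewrite normr0 (le_trans _ (ZC w)).
- move=> w; apply: cvg_near_cst; exists (K w).+1 => //= n /= Kn.
  by rewrite patchT// inE.
Qed.

End bounded_expectation.

(** * Probability generating functions *)

Section nat_random_variables.
Context (R : realType) (d : measure_display) (T : measurableType d).
Variable P : probability T R.
Implicit Types (K X : T -> nat) (g : nat -> R).

Definition nat_pmf K (k : nat) : R := fine (P (K @^-1` [set k])).

Definition pgf K (u : R) : R := \int[P]_w u ^+ K w.

Lemma fine_probability (A : set T) : measurable A -> (fine (P A))%:E = P A.
Proof. by move=> mA; rewrite fineK// fin_num_measure. Qed.

Lemma fine_probability_le1 (A : set T) : measurable A -> fine (P A) <= 1.
Proof. by move=> mA; rewrite -lee_fin fine_probability// probability_le1. Qed.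

Lemma Rintegral_fibre K g k : measurable_fun setT K ->
  \int[P]_(w in K @^-1` [set k]) g (K w) = g k * nat_pmf K k.
Proof.
move=> mK; have mKk := (measurable_fun_natP K).1 mK k.
by rewrite -Rintegral_cst//; apply: eq_Rintegral => w /[!inE] /= ->.
Qed.

Lemma cvg_sum_nat_pmf K g (C : R) : measurable_fun setT K ->
  (forall k, `|g k| <= C) ->
  \sum_(k < n) g k * nat_pmf K k @[n --> \oo] --> \int[P]_w g (K w).
Proof.
move=> mK gC; have mgK := measurable_natf g mK.
have := cvg_Rintegral_fibres (P := P) mK mgK (fun w => gC (K w)).
by under eq_fun do under eq_bigr do rewrite Rintegral_fibre//.
Qed.

(** The error is the integral of u^K over the event n <= K. The probability of
that event is kept because, for n >= 1, it is O(h) when K is the value at a small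
time h of a generalized Poisson process. *)
Lemma pgf_truncation K (u : R) n : measurable_fun setT K -> `|u| <= 1 ->
  `|pgf K u - \sum_(k < n) u ^+ k * nat_pmf K k| <=
  `|u| ^+ n * fine (P [set w | (n <= K w)%N]).
Proof.
move=> mK u1; have mu : measurable_fun setT (fun w => u ^+ K w).
  exact: (measurable_natf (fun k => u ^+ k)).
have uC w : `|u ^+ K w| <= 1 by exact: normr_exprn_le1.
have mlt : measurable [set w | (K w < n)%N].
  exact: (measurable_preimage_nat [set k | (k < n)%N]).
have mge : measurable [set w | (n <= K w)%N].
  exact: (measurable_preimage_nat [set k | (n <= k)%N]).
have -> : \sum_(k < n) u ^+ k * nat_pmf K k =
    \int[P]_(w in [set w | (K w < n)%N]) u ^+ K w.
  rewrite (Rintegral_lt_nat P n mK mu uC); apply: eq_bigr => k _.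
  by rewrite (Rintegral_fibre (fun k => u ^+ k)).
have TE : setT = [set w | (K w < n)%N] `|` [set w | (n <= K w)%N].
  by apply/seteqP; split=> // w _ /=; case: ltnP; [left|right].
rewrite /pgf TE Rintegral_setU//; last 2 first.
- by rewrite -TE; apply: bounded_integrable uC.
- by apply/disj_setPS => w /= []; rewrite ltnNge => /negP.
rewrite addrAC subrr add0r -Rintegral_cst//.
apply: (le_trans (le_normr_Rintegral _ _)) => //.
  exact: bounded_integrable uC.
apply: le_Rintegral => //.
- apply: (@bounded_integrable _ _ _ _ _ _ 1) => //; first exact: measurableT_comp.
  by move=> w; rewrite normr_id.
- apply: (@bounded_integrable _ _ _ _ _ (cst _) (`|u| ^+ n)) => //= _.
  by rewrite normrX normr_id.
- by move=> w /= nK; rewrite normrX ler_wiXn2l.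
Qed.

(** Both sides are sums of the same series, over the fibres of X. *)
Lemma Rintegral_indep A X g (C : R) : measurable A -> measurable_fun setT X ->
  (forall k, `|g k| <= C) ->
  (forall k, P (A `&` X @^-1` [set k]) = P A * P (X @^-1` [set k]))%E ->
  \int[P]_(w in A) g (X w) = fine (P A) * \int[P]_w g (X w).
Proof.
move=> mA mX gC indep.
have mXk k := (measurable_fun_natP X).1 mX k.
have mgX := measurable_natf g mX.
have mZ : measurable_fun setT ((g \o X) \_ A).
  by apply/(measurable_restrictT (g \o X) mA); exact: measurable_funTS.
have ZC w : `|((g \o X) \_ A) w| <= C.
  by rewrite /patch; case: ifPn => //= _; rewrite normr0 (le_trans _ (gC 0%N)).
have lhs := cvg_Rintegral_fibres (P := P) mX mZ ZC.
rewrite -Rintegral_mkcond in lhs.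
have sumE n : \sum_(k < n) \int[P]_(w in X @^-1` [set (k : nat)]) ((g \o X) \_ A) w =
    fine (P A) * \sum_(k < n) g k * nat_pmf X k.
  rewrite mulr_sumr; apply: eq_bigr => k _ /=.
  rewrite -Rintegral_mkcondr setIC.
  rewrite (@eq_Rintegral _ _ _ _ _ (cst (g k))); last by move=> w /[!inE] -[_ /= ->].
  rewrite Rintegral_cst; last exact: measurableI.
  by rewrite [X in _ * X](congr1 fine (indep k)) fineM ?fin_num_measure// mulrCA.
rewrite (funext sumE) in lhs.
apply: (cvg_unique _ lhs) => //.
exact: cvgM (cvg_cst (fine (P A))) (cvg_sum_nat_pmf mX gC).
Qed.

Lemma measurable_mixture K (M : nat -> T -> nat) (g : nat -> nat -> R) :
  measurable_fun setT K -> (forall k, measurable_fun setT (M k)) ->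
  measurable_fun setT (fun w => g (K w) (M (K w) w)).
Proof.
move=> mK mM _ B mB; rewrite setTI.
rewrite (_ : _ @^-1` B = \bigcup_k (K @^-1` [set k] `&` (g k \o M k) @^-1` B)).
  apply: bigcup_measurable => k _.
  apply: measurableI; first exact: (measurable_fun_natP K).1.
  by rewrite -[X in measurable X]setTI; exact: (measurable_natf (g k) (mM k)).
by apply/seteqP; split=> [w gB|w [k _ [/= -> //]]]; exists (K w).
Qed.

(** Fubini for a discrete mixture: when the index K is independent of each M k,
integrating over the fibres of K replaces M k by its own average. It serves with
M constant for the sum of two independent variables, and with M k the Poisson
process at the k-th grid time for the subordination. *)
Lemma Rintegral_mixture K (M : nat -> T -> nat) (g : nat -> nat -> R) (C : R) :
  measurable_fun setT K -> (forall k, measurable_fun setT (M k)) ->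
  (forall k j, `|g k j| <= C) ->
  (forall k j, P (K @^-1` [set k] `&` M k @^-1` [set j]) =
               P (K @^-1` [set k]) * P (M k @^-1` [set j]))%E ->
  \int[P]_w g (K w) (M (K w) w) =
  \int[P]_w \int[P]_v g (K w) (M (K w) v).
Proof.
move=> mK mM gC indep.
have mKk k := (measurable_fun_natP K).1 mK k.
have mZ := measurable_mixture g mK mM.
have psiC k : `|\int[P]_v g k (M k v)| <= C.
  have igk := bounded_integrable P measurableT (measurable_natf (g k) (mM k))
    (fun w => gC k (M k w)).
  apply: (le_trans (le_normr_Rintegral _ igk)) => //.
  rewrite -[leRHS](Rintegral_cstT P).
  apply: le_Rintegral => //.
    apply: (@bounded_integrable _ _ _ _ _ _ C) => //.
      exact: (measurableT_comp _ (measurable_natf (g k) (mM k))).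
    by move=> w; rewrite normr_id; exact: gC.
  by apply: (@bounded_integrable _ _ _ _ _ (cst C) `|C|).
  by move=> w _; exact: gC.
have lhs := cvg_Rintegral_fibres (P := P) mK mZ (fun w => gC _ _).
have sumE n : \sum_(k < n) \int[P]_(w in K @^-1` [set (k : nat)]) g (K w) (M (K w) w) =
    \sum_(k < n) (\int[P]_v g k (M k v)) * nat_pmf K k.
  apply: eq_bigr => k _.
  rewrite (@eq_Rintegral _ _ _ _ _ (fun w => g k (M k w))); last by move=> w /[!inE] /= ->.
  by rewrite (Rintegral_indep (mKk k) (mM k) (gC k) (indep k)) mulrC.
rewrite (funext sumE) in lhs.
exact: (cvg_unique _ lhs (cvg_sum_nat_pmf mK psiC)).
Qed.

End nat_random_variables.

Lemma expectation_pgf (R : realType) (d : measure_display) (T : measurableType d)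
    (P : probability T R) (X : T -> nat) (u : R) :
  measurable_fun setT X -> `|u| <= 1 ->
  'E_P[(fun w => u ^+ X w)%R]%E = (pgf P X u)%:E.
Proof.
move=> mX u1; rewrite unlock /pgf /Rintegral fineK//.
apply: integrable_fin_num => //.
apply: bounded_integrable (fun w => normr_exprn_le1 _ u1) => //.
exact: (measurable_natf (fun k => u ^+ k) mX).
Qed.

Lemma pgf_eq (R : realType) (d d' : measure_display) (T : measurableType d)
    (T' : measurableType d') (P : probability T R) (P' : probability T' R)
    (X : T -> nat) (Y : T' -> nat) (u : R) :
  measurable_fun setT X -> measurable_fun setT Y -> `|u| <= 1 ->
  (forall k, nat_pmf P X k = nat_pmf P' Y k) -> pgf P X u = pgf P' Y u.
Proof.
move=> mX mY u1 XY.
have := cvg_sum_nat_pmf (P := P) mX (fun k => normr_exprn_le1 k u1).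
under eq_fun do under eq_bigr do rewrite XY.
move=> lhs; apply: (cvg_unique _ lhs) => //.
exact: (cvg_sum_nat_pmf (P := P') mY (fun k => normr_exprn_le1 k u1)).
Qed.

Section laws_on_nat.
Context (R : realType) (d d' : measure_display).
Context (T : measurableType d) (T' : measurableType d').
Variables (P : probability T R) (P' : probability T' R).
Variables (X : T -> nat) (Y : T' -> nat).
Hypotheses (mX : measurable_fun setT X) (mY : measurable_fun setT Y).

(** Induction on k: once the coefficients below m agree, truncating both
functions after the term of index m bounds u^m |p_m - q_m| by 2 u^(m+1), and u
can be taken arbitrarily small. *)
Lemma pgf_inj : (forall u, 0 < u < 1 -> pgf P X u = pgf P' Y u) ->
  forall k, nat_pmf P X k = nat_pmf P' Y k.
Proof.
move=> XY k; elim/ltn_ind: k => m IHm.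
apply/eqP; rewrite -subr_eq0 -normr_le0; apply/ler_addgt0Pr => e e0; rewrite add0r.
pose u := Num.min (e / 2) (1 / 2).
have u0 : 0 < u by rewrite /u lt_min !divr_gt0.
have u1 : u < 1 by rewrite /u gt_min; apply/orP; right; lra.
have ue : u * 2 <= e by rewrite -ler_pdivlMr// /u ge_min lexx.
have u1' : `|u| <= 1 by rewrite gtr0_norm// ltW.
have bound d0 (T0 : measurableType d0) (Q : probability T0 R) (Z : T0 -> nat) :
    measurable_fun setT Z ->
    `|pgf Q Z u - \sum_(k < m.+1) u ^+ k * nat_pmf Q Z k| <= u ^+ m.+1.
  move=> mZ; apply: (le_trans (pgf_truncation _ _ mZ u1')).
  rewrite gtr0_norm// ler_piMr//; first by rewrite exprn_ge0// ltW.
  apply: fine_probability_le1.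
  exact: (measurable_preimage_nat [set k | (m.+1 <= k)%N]).
have um0 : 0 < u ^+ m by rewrite exprn_gt0.
rewrite -(ler_pM2l um0) (le_trans _ (ler_wpM2l (ltW um0) ue))// mulrA -exprSr.
have -> : u ^+ m * `|nat_pmf P X m - nat_pmf P' Y m| =
    `|(pgf P' Y u - \sum_(k < m.+1) u ^+ k * nat_pmf P' Y k) -
      (pgf P X u - \sum_(k < m.+1) u ^+ k * nat_pmf P X k)|.
  rewrite XY ?u0// -[in LHS](gtr0_norm um0) -normrM; congr `|_|.
  rewrite !big_ord_recr/=.
  have -> : \sum_(k < m) u ^+ k * nat_pmf P X k = \sum_(k < m) u ^+ k * nat_pmf P' Y k.
    by apply: eq_bigr => k _; rewrite IHm.
  by ring.
rewrite (le_trans (ler_normB _ _))// mulr_natr mulr2n lerD//; exact: bound.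
Qed.

(** The probability of A is the sum of the series of the mass function weighted by
the indicator of A. *)
Lemma nat_law_eq : (forall k, nat_pmf P X k = nat_pmf P' Y k) ->
  equal_in_law P P' X Y.
Proof.
move=> XY; split=> // A mA.
have lawE d0 (T0 : measurableType d0) (Q : probability T0 R) (Z : T0 -> nat) :
    measurable_fun setT Z ->
    \sum_(k < n) \1_A (k : nat) * nat_pmf Q Z k @[n --> \oo] --> fine (Q (Z @^-1` A)).
  move=> mZ; have -> : fine (Q (Z @^-1` A)) = \int[Q]_w (\1_A (Z w)).
    rewrite /Rintegral -[in LHS](setIT (Z @^-1` A)) -integral_indic//.
    exact: measurable_preimage_nat.
  apply: (cvg_sum_nat_pmf (C := 1)) => // k.
  by rewrite indicE ger0_norm ?ler0n// lern1 leq_b1.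
have := lawE _ _ P' _ mY; under eq_fun do under eq_bigr do rewrite -XY.
move=> /(cvg_unique _ (lawE _ _ P _ mX)) => /(_ (@Rhausdorff R)) PP'.
rewrite -(fine_probability P) 1?PP' ?fine_probability//.
- exact: measurable_preimage_nat.
- exact: measurable_preimage_nat.
Qed.

End laws_on_nat.

(** * Subordination of a Poisson process *)

Lemma pgf_poisson (R : realType) (d : measure_display) (T : measurableType d)
    (P : probability T R) (X : T -> nat) (x u : R) :
  measurable_fun setT X -> 0 < x ->
  (forall k, nat_pmf P X k = poisson_pmf x k) -> `|u| <= 1 ->
  pgf P X u = expR (- x * (1 - u)).
Proof.
move=> mX x0 Xpoisson u1.
have := cvg_sum_nat_pmf (P := P) mX (fun k => normr_exprn_le1 k u1).
have sumE n : \sum_(k < n) u ^+ k * nat_pmf P X k =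
    expR (- x) * series (exp_coeff (u * x)) n.
  rewrite /series/= big_mkord mulr_sumr; apply: eq_bigr => k _.
  by rewrite Xpoisson /poisson_pmf x0 /exp_coeff/= exprMn; ring.
rewrite (funext sumE) => lhs.
transitivity (expR (- x) * expR (u * x)); last by rewrite -expRD; congr expR; ring.
apply: (cvg_unique _ lhs) => //.
exact: cvgM (cvg_cst (expR (- x))) (is_cvg_series_exp_coeff (u * x)).
Qed.

Section subordination.
Context (R : realType) (lambda : R).
Context (d : measure_display) (T : measurableType d) (P : probability T R).
Variables (N : R -> {RV P >-> nat}) (H : R -> {RV P >-> R}).
Hypotheses (lambda_gt0 : 0 < lambda) (hN : is_poisson_process lambda N).

Lemma pgf_poisson_process (s u : R) : 0 <= s -> `|u| <= 1 ->
  pgf P (N s) u = expR (- s * (lambda * (1 - u))).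
Proof.
rewrite le_eqVlt => /predU1P[<-|s0] u1.
  rewrite oppr0 mul0r expR0 /pgf.
  rewrite (@eq_Rintegral _ _ _ _ _ (cst 1)).
    exact: Rintegral_cstT.
  by move=> w _; rewrite (poisson_process0 hN).
rewrite (@pgf_poisson _ _ _ _ _ (lambda * s))//.
- by congr expR; ring.
- by rewrite mulr_gt0.
- move=> k; have := poisson_process_law hN k (lexx 0) s0.
  rewrite subr0 => /(congr1 fine) /= <-; congr (fine (P _)).
  apply/seteqP; split=> w; rewrite /increment /real_process/=.
    by rewrite (poisson_process0 hN) subr0 => ->.
  by rewrite (poisson_process0 hN) subr0 => /eqP; rewrite eqr_nat => /eqP.
Qed.

Hypotheses (hH : is_subordinator H) (hNH : independent_processes P N H).
Variables (t : R) (t_ge0 : 0 <= t).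

(** The index of the first grid time, at mesh 1 / (n + 1), strictly after H t:
right-continuity of N can only be used along times larger than H t. *)
Definition grid_index n (w : T) : nat := (Num.trunc (n.+1%:R * H t w)).+1.

Definition grid_time n (k : nat) : R := k%:R / n.+1%:R.

Lemma subordinator_ge0 w : 0 <= H t w.
Proof. by rewrite -(subordinator0 hH w) (subordinator_nondecreasing hH). Qed.

(** The fibres are stated as preimages by H t, and not merely as measurable sets,
so that they belong to the sigma-algebra generated by H. *)
Lemma grid_index_fibre n k : exists2 B, measurable B &
  grid_index n @^-1` [set k] = H t @^-1` B.
Proof.
case: k => [|k]; first by exists set0 => //; apply/seteqP; split.
exists `[k%:R / n.+1%:R, k.+1%:R / n.+1%:R[%classic => //.
apply/seteqP; split => w /=.
  move=> [] /eqP; rewrite truncn_eq ?mulr_ge0 ?subordinator_ge0//.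
  by rewrite in_itv/= ler_pdivrMr// ltr_pdivlMr// mulrC.
rewrite in_itv/= ler_pdivrMr// ltr_pdivlMr// mulrC => Hk.
by congr S; apply/eqP; rewrite truncn_eq ?mulr_ge0 ?subordinator_ge0.
Qed.

Lemma measurable_grid_index n : measurable_fun setT (grid_index n).
Proof.
apply/measurable_fun_natP => k; have [B mB ->] := grid_index_fibre n k.
by rewrite -[X in measurable X]setTI; exact: measurable_funP.
Qed.

Lemma grid_indep n k j :
  (P (grid_index n @^-1` [set k] `&` N (grid_time n k) @^-1` [set j]) =
   P (grid_index n @^-1` [set k]) * P (N (grid_time n k) @^-1` [set j]))%E.
Proof.
rewrite setIC muleC; apply: hNH.
  apply: sub_sigma_algebra; exists (grid_time n k); first by rewrite /= divr_ge0.
  by exists [set j] => //; rewrite setTI.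
have [B mB ->] := grid_index_fibre n k.
apply: sub_sigma_algebra; exists t => //.
by exists B => //; rewrite setTI.
Qed.

Lemma grid_time_gt n w : H t w < grid_time n (grid_index n w).
Proof. by rewrite /grid_time ltr_pdivlMr// mulrC truncnS_gt. Qed.

Lemma cvg_grid_time w : grid_time n (grid_index n w) @[n --> \oo] --> H t w.
Proof.
apply: (@squeeze_cvgr _ _ _ _ (cst (H t w)) (fun n => H t w + n.+1%:R^-1)).
- apply: nearW => n; rewrite ltW ?grid_time_gt//= /grid_time.
  rewrite ler_pdivrMr// mulrDl mulVf ?pnatr_eq0// /grid_index.
  rewrite -[X in X <= _]natr1 lerD2r [X in _ <= X]mulrC.
  by rewrite truncn_le ?mulr_ge0 ?subordinator_ge0.
- exact: cvg_cst.
- by rewrite -[X in _ --> X]addr0; apply: cvgD; [exact: cvg_cst|exact: cvg_harmonic].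
Qed.

Lemma subordinated_grid w : \forall n \near \oo,
  N (grid_time n (grid_index n w)) w = subordinated N H t w.
Proof.
have := (cvg_at_rightP _ _ _).1
  (poisson_process_right_continuous hN (w := w) (subordinator_ge0 w)) _
  (conj (fun n => grid_time_gt n w) (@cvg_grid_time w)).
move=> /cvgrPdist_lt /(_ 1 ltr01); apply: filterS => n.
by rewrite /real_process /subordinated distrC => /natr_dist_lt1.
Qed.

(** Pointwise limit of the measurable maps obtained on the grids. *)
Lemma measurable_subordinated : measurable_fun setT (subordinated N H t).
Proof.
have mNH : measurable_fun setT (fun w => (subordinated N H t w)%:R : R).
  apply: (@measurable_fun_cvg _ _ _ _
    (fun n w => (N (grid_time n (grid_index n w)) w)%:R)) => [n|w _].
    exact: (measurable_mixture (fun _ j => j%:R) (measurable_grid_index n)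
      (M := fun k => N (grid_time n k))).
  apply: cvg_near_cst; apply: filterS (subordinated_grid w) => n ->//.
apply/measurable_fun_natP => k.
have := mNH measurableT _ (measurable_set1 (k%:R : R)); rewrite setTI.
congr measurable; apply/seteqP; split=> w /=; last by move=> ->.
by move=> /eqP; rewrite eqr_nat => /eqP.
Qed.

(** On the grid of mesh 1 / (n + 1) the mixture lemma computes the pgf; both sides
then pass to the limit, the integrands being bounded by 1. *)
Lemma pgf_subordinated (u : R) : `|u| <= 1 ->
  pgf P (subordinated N H t) u =
  \int[P]_w expR (- (lambda * (1 - u)) * H t w).
Proof.
move=> u1; pose mu := lambda * (1 - u).
have mu0 : 0 <= mu.
  by rewrite mulr_ge0 ?(ltW lambda_gt0)// subr_ge0 (le_trans (ler_norm u)).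
have lhs : \int[P]_w u ^+ N (grid_time n (grid_index n w)) w @[n --> \oo] -->
    pgf P (subordinated N H t) u.
  apply: (@bounded_cvg_Rintegral _ _ _ _ _ _ 1) => [n|n w|w].
  - exact: (measurable_mixture (fun _ j => u ^+ j) (measurable_grid_index n)
      (M := fun k => N (grid_time n k))).
  - exact: normr_exprn_le1.
  - by apply: cvg_near_cst; apply: filterS (subordinated_grid w) => n ->.
apply: (cvg_unique _ lhs) => //.
have mixE n : \int[P]_w u ^+ N (grid_time n (grid_index n w)) w =
    \int[P]_w expR (- mu * grid_time n (grid_index n w)).
  rewrite (@Rintegral_mixture _ _ _ _ _ (fun k => N (grid_time n k))
    (fun _ j => u ^+ j) 1) //.
  - apply: eq_Rintegral => w _.
    rewrite -/(pgf P (N _) u) pgf_poisson_process ?divr_ge0//.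
    by congr expR; rewrite /mu; ring.
  - exact: measurable_grid_index.
  - by move=> _ j; exact: normr_exprn_le1.
  - exact: grid_indep.
rewrite (funext mixE).
apply: (@bounded_cvg_Rintegral _ _ _ _ _ _ 1) => [n|n w|w].
- exact: (measurable_natf (fun k => expR (- mu * grid_time n k))
    (measurable_grid_index n)).
- rewrite ger0_norm ?expR_ge0// -expR0 ler_expR mulNr oppr_le0 mulr_ge0//.
  by rewrite divr_ge0.
- have cz : - mu * grid_time n (grid_index n w) @[n --> \oo] --> - mu * H t w.
    by apply: cvgM; [exact: cvg_cst|exact: cvg_grid_time].
  exact: (cvg_comp _ _ cz (@continuous_expR R _)).
Qed.

End subordination.

(** * Multiplicativity of the generating function *)

Section multiplicativity.
Context (R : realType) (lambda : R) (nu : {measure set R -> \bar R}).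
Context (d : measure_display) (T : measurableType d) (P : probability T R).
Variable X : R -> {RV P >-> nat}.
Hypothesis hX : is_generalized_poisson lambda nu X.

Let incr s h := increment (real_process X) s (s + h).

(** An increment lies in this set exactly when the truncated difference on nat is
k. The paths need not be monotone, so an increment can be negative; by
stationarity it is almost surely equal to the truncated difference. *)
Let trunc_fibre (k : nat) : set R :=
  if k is 0%N then `]-oo, 0]%classic else [set k%:R].

Let measurable_trunc_fibre k : measurable (trunc_fibre k).
Proof. by case: k => [|k] /=. Qed.

Let trunc_fibre_natr (k n : nat) : trunc_fibre k n%:R <-> n = k.
Proof.
case: k => [|k] /=; rewrite ?in_itv/=; last first.
  by split=> [/eqP|->//]; rewrite eqr_nat => /eqP.
by rewrite lern0; split=> [/eqP|->].
Qed.

Let subn_fibre s h k :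
  (fun w => X (s + h) w - X s w)%N @^-1` [set k] = incr s h @^-1` trunc_fibre k.
Proof.
apply/seteqP; rewrite /incr /increment /real_process.
have E w : trunc_fibre k ((X (s + h) w)%:R - (X s w)%:R) <->
    (X (s + h) w - X s w)%N = k.
  have [le|lt] := leqP (X s w) (X (s + h) w).
    by rewrite -natrB// trunc_fibre_natr.
  rewrite (eqP (ltnW lt)).
  have lt' : ((X (s + h) w)%:R - (X s w)%:R : R) < 0 by rewrite subr_lt0 ltr_nat.
  case: k => [|k] /=; rewrite ?in_itv/= ?ltW//; split => // kE.
  by move: lt'; rewrite kE ltrn0.
by split=> w /E.
Qed.

(** The increment over [s, s + h] has the law of X h, as X 0 = 0. *)
Let law_subn s h k : 0 <= s -> 0 <= h ->
  P ((fun w => X (s + h) w - X s w)%N @^-1` [set k]) = P (X h @^-1` [set k]).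
Proof.
move=> s0 h0; rewrite subn_fibre.
have [_ _ ->//] := generalized_poisson_stat hX s0 (lexx 0) h0.
congr (P _); apply/seteqP; rewrite /increment /real_process add0r.
by split=> w /=; rewrite (generalized_poisson0 hX) subr0 => /trunc_fibre_natr.
Qed.

Lemma generalized_poisson_fibre s k :
  X s @^-1` [set k] = increment (real_process X) 0 s @^-1` [set k%:R].
Proof.
apply/seteqP; rewrite /increment /real_process.
split=> w /=; rewrite (generalized_poisson0 hX) subr0; first by move=> ->.
by move=> /eqP; rewrite eqr_nat => /eqP.
Qed.

Let indep_subn s h j k : 0 <= s -> 0 <= h ->
  (P (X s @^-1` [set j] `&` (fun w => X (s + h) w - X s w)%N @^-1` [set k]) =
   P (X s @^-1` [set j]) * P ((fun w => X (s + h) w - X s w)%N @^-1` [set k]))%E.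
Proof.
move=> s0 h0; rewrite subn_fibre generalized_poisson_fibre.
pose t i := if i is i'.+1 then if i' is 0%N then s else s + h else 0 : R.
pose A (i : 'I_2) := if i == ord0 then [set j%:R] else trunc_fibre k.
have mA i : measurable (A i) by rewrite /A; case: ifP.
have tS i : t i <= t i.+1.
  by case: i => [|[|i]]//=; rewrite lerDl.
have := generalized_poisson_indep hX (lexx 0 : 0 <= t 0%N) tS mA.
rewrite !big_ord_recl big_ord0 mule1 /= /A/= => <-.
congr (P _); apply/seteqP; split=> [w [Aw Bw] [[|[|//]] lei] _ /=|w Aw] //.
by split; [exact: (Aw ord0)|exact: (Aw (lift ord0 ord0))].
Qed.

(** X (s + h) is almost surely the sum of X s and an independent copy of X h. *)
Lemma generalized_poisson_pgfD (s h u : R) : 0 <= s -> 0 <= h -> `|u| <= 1 ->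
  pgf P (X (s + h)) u = pgf P (X s) u * pgf P (X h) u.
Proof.
move=> s0 h0 u1; pose D w := (X (s + h) w - X s w)%N.
have mX r : measurable_fun setT (X r) by exact: measurable_funP.
have mD : measurable_fun setT D.
  apply/measurable_fun_natP => k; rewrite subn_fibre.
  have [mI _ _] := generalized_poisson_stat hX s0 s0 h0.
  by rewrite -[X in measurable X]setTI; exact: mI.
transitivity (\int[P]_w u ^+ (X s w + D w)).
  congr fine; apply: ae_eq_integral => //.
  - apply/measurable_EFinP.
    exact: (measurable_natf (fun k => u ^+ k) (mX (s + h))).
  - apply/measurable_EFinP.
    exact: (measurable_mixture (M := fun=> D) (fun k j => u ^+ (k + j)) (mX s)).
  have [_ _ E] := generalized_poisson_stat hX s0 (lexx 0) h0.
  (* The two integrands differ only where the increment is negative. *)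
  exists (incr s h @^-1` `]-oo, 0[%classic); split.
  - have [mI _ _] := generalized_poisson_stat hX s0 s0 h0.
    by rewrite -[X in measurable X]setTI; exact: mI.
  - rewrite [LHS]E// (_ : _ @^-1` _ = set0) ?measure0//.
    apply/seteqP; split=> // w /=; rewrite /increment /real_process add0r.
    by rewrite (generalized_poisson0 hX) subr0 in_itv/= ltrn0.
  - move=> w /= ne; rewrite in_itv/= /incr /increment /real_process subr_lt0 ltr_nat.
    by rewrite ltnNge; apply/negP => le; apply: ne => _; rewrite /D subnKC.
rewrite (@Rintegral_mixture _ _ _ _ (X s) (fun=> D) (fun k j => u ^+ (k + j)) 1) //.
- transitivity (\int[P]_w (u ^+ X s w * pgf P (X h) u)).
    apply: eq_Rintegral => w _; rewrite -(@pgf_eq _ _ _ _ _ P P D)//; last first.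
      by move=> k; rewrite /nat_pmf law_subn.
    rewrite -RintegralZl//.
      by apply: eq_Rintegral => v _; rewrite exprD.
    apply: bounded_integrable (fun w => normr_exprn_le1 _ u1) => //.
    exact: (measurable_natf (fun k => u ^+ k) mD).
  rewrite RintegralZr//.
  apply: bounded_integrable (fun w => normr_exprn_le1 _ u1) => //.
  exact: (measurable_natf (fun k => u ^+ k) (mX s)).
- by move=> k j; exact: normr_exprn_le1.
- by move=> k j; exact: indep_subn.
Qed.

Lemma generalized_poisson_pgfX (h u : R) m : 0 <= h -> `|u| <= 1 ->
  pgf P (X (m%:R * h)) u = pgf P (X h) u ^+ m.
Proof.
move=> h0 u1; elim: m => [|m IHm].
  rewrite mul0r expr0 /pgf (@eq_Rintegral _ _ _ _ _ (cst 1)).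
    exact: Rintegral_cstT.
  by move=> w _; rewrite (generalized_poisson0 hX).
by rewrite -natr1 mulrDl mul1r generalized_poisson_pgfD ?mulr_ge0// IHm exprSr.
Qed.

End multiplicativity.

(** * The Bernstein function *)

Section bernstein_function.
Context (R : realType) (nu : {measure set R -> \bar R}).
Hypothesis hnu : is_bernstein_measure nu.

Let pos : set R := `]0, +oo[%classic.

Let mpos : measurable pos. Proof. exact: measurable_itv. Qed.

(** 1 - exp(- x s) <= max(1, x) min(s, 1). *)
Lemma integrable_bernstein (x : R) : 0 <= x ->
  nu.-integrable pos (EFin \o (fun s => 1 - expR (- x * s))).
Proof.
move=> x0.
have imin : nu.-integrable pos (EFin \o (fun s => Num.min s 1)).
  apply/integrableP; split.
    by apply/measurable_EFinP; exact: measurable_minr.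
  apply: le_lt_trans (bernstein_measure_integral hnu).
  rewrite le_eqVlt; apply/orP; left; apply/eqP; apply: eq_integral => s.
  rewrite inE /pos/= in_itv/= andbT => s0.
  by rewrite ger0_norm// le_min (ltW s0) ler01.
have imin' := integrableZl mpos (Num.max 1 x) imin.
apply: (le_integrable mpos _ _ imin').
  apply/measurable_EFinP; apply: measurable_funB => //.
  by apply: measurableT_comp => //; exact: measurable_funM.
move=> s; rewrite /pos/= in_itv/= andbT => s0.
rewrite lee_fin normrM.
have m0 : 0 <= Num.min s 1 by rewrite le_min (ltW s0) ler01.
have M0 : 0 <= Num.max 1 x by rewrite le_max ler01.
have xs0 : 0 <= x * s by rewrite mulr_ge0// ltW.
rewrite !ger0_norm//; last first.
  by rewrite subr_ge0 -expR0 ler_expR mulNr oppr_le0.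
have [s1|s1] := leP s 1.
  rewrite (@le_trans _ _ (x * s))//.
    by rewrite lerBlDr -lerBlDl -mulNr expR_ge1Dx.
  by rewrite ler_wpM2r ?le_max ?lexx ?orbT// ltW.
rewrite mulr1 (@le_trans _ _ 1)// ?le_max ?lexx//.
Qed.

Lemma bernstein_ge0 (x : R) : 0 <= x -> 0 <= bernstein nu x.
Proof.
move=> x0; apply: Rintegral_ge0 => s; rewrite /= in_itv/= andbT => s0.
by rewrite subr_ge0 -expR0 ler_expR mulNr oppr_le0 mulr_ge0// ltW.
Qed.

(** Summing the exponential series under the integral, u^k jump_rate(k) adds up to
the integral of exp(- lambda s) (exp(lambda u s) - 1), which is
(1 - exp(- lambda s)) - (1 - exp(- lambda (1 - u) s)). The partial sums are
dominated by 1 - exp(- lambda s), because u < 1. *)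
Lemma cvg_jump_rate_series (lambda u : R) : 0 < lambda -> 0 < u < 1 ->
  \sum_(k < n) u ^+ k.+1 * jump_rate lambda nu k.+1 @[n --> \oo] -->
  bernstein nu lambda - bernstein nu (lambda * (1 - u)).
Proof.
move=> l0 /andP[u0 u1].
have iG : nu.-integrable pos (EFin \o (fun s => 1 - expR (- lambda * s))).
  by apply: integrable_bernstein; exact: ltW.
have iF : nu.-integrable pos
    (EFin \o (fun s => 1 - expR (- (lambda * (1 - u)) * s))).
  by apply: integrable_bernstein; rewrite mulr_ge0 ?(ltW l0)// subr_ge0 ltW.
pose c (s : R) k := exp_coeff (lambda * u * s) k.+1.
pose f n (s : R) := expR (- lambda * s) * \sum_(k < n) c s k.
have mf n : measurable_fun pos (f n).
  apply: measurable_funTS; apply: measurable_funM.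
    by apply: measurableT_comp => //; exact: measurable_funM.
  apply: measurable_sum => k; apply: measurable_funM => //.
  by apply: measurable_funX; exact: measurable_funM.
have c0 s k : pos s -> 0 <= c s k.
  rewrite /pos/= in_itv/= andbT => s0; apply: exp_coeff_ge0.
  by rewrite !mulr_ge0// ltW.
have f0 s n : pos s -> 0 <= f n s.
  by move=> s0; rewrite mulr_ge0 ?expR_ge0// sumr_ge0// => k _; exact: c0.
have sumE s n : \sum_(k < n) c s k = series (exp_coeff (lambda * u * s)) n.+1 - 1.
  rewrite /series/= big_mkord big_ord_recl /exp_coeff/= expr0 fact0 divr1.
  rewrite addrAC subrr add0r.
  by apply: eq_bigr.
have fG n s : pos s -> `|f n s| <= 1 - expR (- lambda * s).
  move=> ps; rewrite ger0_norm ?f0// /f sumE.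
  move: ps; rewrite /pos/= in_itv/= andbT => s0.
  have E : expR (- lambda * s) * expR (lambda * s) = 1.
    by rewrite -expRD mulNr addNr expR0.
  rewrite -[X in _ <= X - _]E -[X in _ <= _ - X]mulr1 -mulrBr.
  rewrite ler_wpM2l ?expR_ge0// lerB//.
  apply: (le_trans (series_exp_coeff_le _ _)); first by rewrite !mulr_ge0// ltW.
  by rewrite ler_expR ler_wpM2r ?(ltW s0)// ler_piMr ?(ltW l0)// ltW.
have inf n : nu.-integrable pos (EFin \o f n).
  apply: (le_integrable mpos _ _ iG); first exact/measurable_EFinP.
  move=> s ps; rewrite lee_fin (le_trans (fG n s ps))// ler_norm//.
have fF s : pos s -> f ^~ s @ \oo -->
    (1 - expR (- lambda * s)) - (1 - expR (- (lambda * (1 - u)) * s)).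
  move=> ps; rewrite (_ : _ - _ =
    expR (- lambda * s) * (expR (lambda * u * s) - 1)); last first.
    have E : expR (- lambda * s) * expR (lambda * u * s) =
        expR (- (lambda * (1 - u)) * s).
      by rewrite -expRD; congr expR; ring.
    by rewrite -E; ring.
  apply: cvgM; first exact: cvg_cst.
  rewrite (funext (sumE s)); apply: cvgB; last exact: cvg_cst.
  rewrite (cvg_shiftS (series (exp_coeff (lambda * u * s)))).
  exact: (is_cvg_series_exp_coeff (lambda * u * s)).
have intE n : \int[nu]_(s in pos) f n s =
    \sum_(k < n) u ^+ k.+1 * jump_rate lambda nu k.+1.
  elim: n => [|n IHn].
    rewrite big_ord0 (@eq_Rintegral _ _ _ _ _ (cst 0)) ?Rintegral_cst ?mul0r//.
    by move=> s _; rewrite /f big_ord0 mulr0.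
  have fS s : f n.+1 s = f n s + expR (- lambda * s) * c s n.
    by rewrite /f big_ord_recr/= mulrDr.
  have ig : nu.-integrable pos (EFin \o (fun s => expR (- lambda * s) * c s n)).
    rewrite (_ : _ \o _ = (EFin \o f n.+1) \- (EFin \o f n))%E; last first.
      by apply/funext => s /=; rewrite fS EFinD addeAC subee// add0e.
    exact: integrableB.
  rewrite big_ord_recr/= -IHn.
  transitivity (\int[nu]_(s in pos) (f n s + expR (- lambda * s) * c s n)).
    by apply: eq_Rintegral => s _; exact: fS.
  rewrite RintegralD//; congr (_ + _).
  have lu0 : lambda * u != 0 by rewrite mulf_neq0 ?lt0r_neq0.
  have fact0 : (n.+1)`!%:R != 0 :> R by rewrite pnatr_eq0 -lt0n fact_gt0.
  (* exp(- lambda s) s^(n+1) is a multiple of the term of index n of the sum. *)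
  have igk : nu.-integrable pos (EFin \o (fun s => expR (- lambda * s) * s ^+ n.+1)).
    have := integrableZl mpos ((n.+1)`!%:R / (lambda * u) ^+ n.+1) ig.
    congr (nu.-integrable _ _); apply/funext => s /=.
    rewrite -EFinM /c /exp_coeff/= !exprMn; congr EFin; field.
    by rewrite fact0 ?expf_neq0 ?lt0r_neq0.
  rewrite /jump_rate mulrA -RintegralZl//.
  apply: eq_Rintegral => s _; rewrite /c /exp_coeff/= !exprMn; field.
  exact: fact0.
rewrite (funext (fun n => esym (intE n))) /bernstein -RintegralB//.
exact: (dominated_cvg_Rintegral mpos mf iG fG fF).
Qed.

End bernstein_function.

(** * Generating function of the generalized Poisson process *)

Section generalized_poisson_pgf.
Context (R : realType) (lambda : R) (nu : {measure set R -> \bar R}).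
Context (d : measure_display) (T : measurableType d) (P : probability T R).
Variable X : R -> {RV P >-> nat}.
Hypotheses (lambda_gt0 : 0 < lambda) (hnu : is_bernstein_measure nu).
Hypothesis hX : is_generalized_poisson lambda nu X.

Lemma cvg_jump_quotient k :
  nat_pmf P (X h) k.+1 / h @[h --> 0^'+] --> jump_rate lambda nu k.+1.
Proof.
have pE : (fun h => nat_pmf P (X h) k.+1) = (fun h : R =>
    fine (P [set w | increment (real_process X) 0 (0 + h) w = k.+1%:R])).
  by apply/funext => h; rewrite add0r /nat_pmf (generalized_poisson_fibre hX).
have gE (h : R) : h * jump_rate lambda nu k.+1 = 0 + h * jump_rate lambda nu k.+1.
  by rewrite add0r.
have oE := generalized_poisson_jump hX (lexx 0) (ltn0Sn k).
rewrite -pE in oE.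
have := littleo_cvg_quotient gE oE.
by under eq_fun do rewrite subr0.
Qed.

Lemma cvg_nojump_quotient :
  (1 - nat_pmf P (X h) 0) / h @[h --> 0^'+] --> bernstein nu lambda.
Proof.
have pE : (fun h => nat_pmf P (X h) 0) = (fun h : R =>
    fine (P [set w | increment (real_process X) 0 (0 + h) w = 0])).
  by apply/funext => h; rewrite add0r /nat_pmf (generalized_poisson_fibre hX).
have gE (h : R) : 1 - h * bernstein nu lambda = 1 + h * (- bernstein nu lambda).
  by rewrite mulrN.
have oE := generalized_poisson_nojump hX (lexx 0).
rewrite -pE in oE.
have := littleo_cvg_quotient gE oE => /cvgN; rewrite opprK.
apply: cvg_trans; apply: near_eq_cvg.
by near=> h; rewrite /= -mulNr opprB.
Unshelve. all: by end_near. Qed.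

Variable u : R.
Hypothesis u01 : 0 < u < 1.

Let u_gt0 : 0 < u. Proof. by case/andP: u01. Qed.
Let u_lt1 : u < 1. Proof. by case/andP: u01. Qed.
Let normu : `|u| = u. Proof. by rewrite gtr0_norm. Qed.
Let normu_le1 : `|u| <= 1. Proof. by rewrite normu ltW. Qed.

Local Notation phi h := (pgf P (X h) u).
Local Notation a := (bernstein nu (lambda * (1 - u))).

(** More than n jumps requires at least one, so the truncation error is at most
u^(n+1) times the probability of a jump. *)
Lemma pgf_tail_quotient n (h : R) : 0 < h ->
  `|(1 - phi h) / h - ((1 - nat_pmf P (X h) 0) / h -
     \sum_(k < n) u ^+ k.+1 * (nat_pmf P (X h) k.+1 / h))| <=
  u ^+ n.+1 * ((1 - nat_pmf P (X h) 0) / h).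
Proof.
move=> h0; have mXh : measurable_fun setT (X h) by exact: measurable_funP.
have := pgf_truncation P n.+1 mXh normu_le1.
rewrite big_ord_recl/= expr0 mul1r normu => tr.
have p0 : fine (P [set w | (n.+1 <= X h w)%N]) <= 1 - nat_pmf P (X h) 0.
  have m0 := (measurable_fun_natP (X h)).1 mXh 0%N.
  have mn : measurable [set w | (n.+1 <= X h w)%N].
    exact: (measurable_preimage_nat [set k | (n.+1 <= k)%N]).
  rewrite -lee_fin EFinB !fine_probability// -probability_setC//.
  apply: le_measure; rewrite ?inE//; first exact: measurableC.
  by move=> w /= nX X0; rewrite X0 in nX.
have -> : (1 - phi h) / h - ((1 - nat_pmf P (X h) 0) / h -
     \sum_(k < n) u ^+ k.+1 * (nat_pmf P (X h) k.+1 / h)) =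
   - (phi h - (nat_pmf P (X h) 0 +
               \sum_(k < n) u ^+ k.+1 * nat_pmf P (X h) k.+1)) / h.
  under eq_bigr do rewrite mulrA.
  by rewrite -mulr_suml; field; exact: lt0r_neq0.
rewrite normrM normrN normfV (gtr0_norm h0) mulrA ler_pM2r ?invr_gt0//.
by apply: (le_trans tr); rewrite ler_wpM2l// exprn_ge0// ltW.
Qed.

(** The truncation order n is fixed first, making both the remainder of the series
of jump rates and the tail small uniformly in h near 0; the finitely many jump
probabilities then converge. *)
Lemma cvg_pgf_quotient : (1 - phi h) / h @[h --> 0^'+] --> a.
Proof.
pose c := bernstein nu lambda.
pose S n := \sum_(k < n) u ^+ k.+1 * jump_rate lambda nu k.+1.
apply/cvgrPdist_le => e e0.
have e3 : 0 < e / 3 by rewrite divr_gt0.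
have /cvgrPdist_le/(_ _ e3) cvgS := cvg_jump_rate_series hnu lambda_gt0 u01.
have cvgu : u ^+ n.+1 * (c + 1) @[n --> \oo] --> 0.
  rewrite -[X in _ --> X](mul0r (c + 1)); apply: cvgM; last exact: cvg_cst.
  rewrite (cvg_shiftS (fun n => u ^+ n)).
  by apply: cvg_expr; rewrite normu.
move/cvgrPdist_le/(_ _ e3): cvgu => cvgu.
have [n _ nn] := filterI cvgS cvgu.
have [Sn un] := nn n (leqnn n).
have cvgL : (1 - nat_pmf P (X h) 0) / h -
     \sum_(k < n) u ^+ k.+1 * (nat_pmf P (X h) k.+1 / h) @[h --> 0^'+] --> c - S n.
  apply: cvgB; first exact: cvg_nojump_quotient.
  apply: cvg_big => [|k _]; first exact: add_continuous.
  apply: cvgM; first exact: cvg_cst.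
  exact: cvg_jump_quotient.
have /cvgrPdist_le/(_ _ ltr01) nearc := cvg_nojump_quotient.
move/cvgrPdist_le/(_ _ e3): cvgL => cvgL.
near=> h.
have h0 : 0 < h by near: h; exact: nbhs_right_gt.
have tail := pgf_tail_quotient n h0.
have hc : `|c - (1 - nat_pmf P (X h) 0) / h| <= 1 by near: h.
have hL : `|c - S n - ((1 - nat_pmf P (X h) 0) / h -
     \sum_(k < n) u ^+ k.+1 * (nat_pmf P (X h) k.+1 / h))| <= e / 3 by near: h.
have uc : u ^+ n.+1 * ((1 - nat_pmf P (X h) 0) / h) <= u ^+ n.+1 * (c + 1).
  rewrite ler_wpM2l ?exprn_ge0 ?(ltW u_gt0)//.
  by move: hc; rewrite distrC ler_norml => /andP[_]; rewrite lerBlDl.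
move: Sn un hL tail; rewrite /= -/c -/(S n) sub0r normrN => Sn un hL tail.
move: (le_trans uc (le_trans (ler_norm _) un)) => {}uc.
move: (le_trans tail uc) Sn hL; rewrite !ler_norml.
move=> /andP[? ?] /andP[? ?] /andP[? ?]; apply/andP; split; lra.
Unshelve. all: by end_near. Qed.

(** With h = t / (m + 1), the difference is at most (m + 1) |phi(h) - exp(- a h)|,
that is t times |phi(h) - exp(- a h)| / h, which tends to 0 since phi(h) and
exp(- a h) both are 1 - a h + o(h). *)
Lemma generalized_poisson_pgf (t : R) : 0 < t -> phi t = expR (- t * a).
Proof.
move=> t0.
have a0 : 0 <= a.
  by apply: bernstein_ge0; rewrite mulr_ge0 ?(ltW lambda_gt0)// subr_ge0 ltW.
pose h (m : nat) := t / m.+1%:R.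
have h0 m : 0 < h m by rewrite divr_gt0.
have cvgh : h m @[m --> \oo] --> 0.
  rewrite -[X in _ --> X](mulr0 t); apply: cvgM; [exact: cvg_cst|exact: cvg_harmonic].
have cvgF : (1 - phi (h m)) / h m @[m --> \oo] --> a.
  exact: (cvg_at_rightP _ _ _).1 cvg_pgf_quotient h (conj h0 cvgh).
have phi_le1 r : `|phi r| <= 1.
  have mXr : measurable_fun setT (X r) by exact: measurable_funP.
  have := pgf_truncation P 0 mXr normu_le1.
  rewrite big_ord0 subr0 expr0 mul1r => /le_trans; apply.
  apply: fine_probability_le1.
  exact: (measurable_preimage_nat [set k | (0 <= k)%N]).
have bound m : `|phi t - expR (- t * a)| <=
    t * `|a - (1 - phi (h m)) / h m| + t * a ^+ 2 * h m.
  have mh : m.+1%:R * h m = t by rewrite /h mulrC divfK// pnatr_eq0.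
  have phit : phi t = phi (h m) ^+ m.+1.
    by rewrite -(generalized_poisson_pgfX hX)// ?mh// ltW.
  have et : expR (- t * a) = expR (- (a * h m)) ^+ m.+1.
    by rewrite -expRM_natl -{1}mh; congr expR; ring.
  have eb : `|expR (- (a * h m))| <= 1.
    rewrite ger0_norm ?expR_ge0// -[X in _ <= X]expR0 ler_expR oppr_le0.
    by rewrite mulr_ge0// (ltW (h0 m)).
  rewrite phit et (le_trans (dist_expr_le _ _ _))//.
  have ah0 : 0 <= a * h m by rewrite mulr_ge0// (ltW (h0 m)).
  have tay := expRN_taylor1 ah0.
  have dec : `|phi (h m) - expR (- (a * h m))| <=
      `|a - (1 - phi (h m)) / h m| * h m + (a * h m) ^+ 2.
    rewrite -[X in _ <= _ * X + _](gtr0_norm (h0 m)) -normrM.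
    rewrite (_ : (a - _) * h m = phi (h m) - (1 - a * h m)); last first.
      by field; exact: lt0r_neq0.
    rewrite (_ : phi (h m) - expR _ = (phi (h m) - (1 - a * h m)) -
      (expR (- (a * h m)) - (1 - a * h m))); last by ring.
    by rewrite (le_trans (ler_normB _ _))// lerD.
  rewrite (le_trans (ler_wpM2l _ dec))//.
  by rewrite -mh le_eqVlt; apply/orP; left; apply/eqP; ring.
apply/eqP; rewrite -subr_eq0 -normr_le0.
have cvgb : t * `|a - (1 - phi (h m)) / h m| + t * a ^+ 2 * h m @[m --> \oo] --> 0.
  rewrite (_ : 0 = t * `|a - a| + t * a ^+ 2 * 0); last first.
    by rewrite subrr normr0 !mulr0 addr0.
  apply: cvgD; apply: cvgM => //; try exact: cvg_cst.
  apply: cvg_norm; apply: cvgB => //; exact: cvg_cst.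
apply: (ler_cvg_to (cvg_cst _) cvgb); exact: nearW.
Qed.

End generalized_poisson_pgf.

(** * Equality in law *)

Theorem mainTheorem2 (R : realType) (lambda : R) (hlambda : 0 < lambda)
    (nu : {measure set R -> \bar R}) (hnu : is_bernstein_measure nu)
    (d : measure_display) (T : measurableType d) (P : probability T R)
    (Nf : R -> {RV P >-> nat}) (hNf : is_generalized_poisson lambda nu Nf)
    (d' : measure_display) (T' : measurableType d') (P' : probability T' R)
    (N : R -> {RV P' >-> nat}) (hN : is_poisson_process lambda N)
    (H : R -> {RV P' >-> R}) (hH : is_subordinator H)
    (hHf : has_laplace_exponent (bernstein nu) H)
    (hNH : independent_processes P' N H) :
  forall t : R, 0 < t ->
    (forall u : R, `|u| < 1 ->
       'E_P'[(fun w => u ^+ subordinated N H t w)%R]%E =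
       (expR (- t * bernstein nu (lambda * (1 - u))))%:E) /\
    equal_in_law P P' (Nf t) (subordinated N H t).
Proof.
move=> t t0; have t_ge0 := ltW t0.
have mNH := measurable_subordinated hN hH t_ge0.
have pgfNH u : `|u| <= 1 ->
    pgf P' (subordinated N H t) u = expR (- t * bernstein nu (lambda * (1 - u))).
  move=> u1; rewrite (pgf_subordinated hlambda hN hH hNH t_ge0 u1).
  have mu0 : 0 <= lambda * (1 - u).
    by rewrite mulr_ge0 ?(ltW hlambda)// subr_ge0 (le_trans (ler_norm u)).
  by have := hHf t _ t_ge0 mu0; rewrite unlock => /(congr1 fine).
split=> [u u1|].
  by rewrite expectation_pgf ?pgfNH// ltW.
have mNf : measurable_fun setT (Nf t) by exact: measurable_funP.
apply: nat_law_eq => //; apply: pgf_inj => // u u01.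
rewrite (generalized_poisson_pgf hlambda hnu hNf u01 t0) pgfNH//.
by case/andP: u01 => u0 u1; rewrite gtr0_norm// ltW.
Qed.
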